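(* Let $S$ be a unital inverse semigroup. Under the usual norm $\|f\|_1=\sum_{x\in S}|f(x)|$, the space $\ell^1(S)$ equipped with the dot product $\bullet$ as multiplication and the map $f\mapsto\tilde f$ as involution is a Banach $*$-algebra.
   Context: An inverse semigroup $S$ is a (discrete) semigroup in which every $s\in S$ has a unique $s^*\in S$ with $ss^*s=s$ and $s^*ss^*=s^*$; here $S$ has an identity $1$. $\ell^1(S)$ is the Banach space of $f:S\to\mathbb C$ with $\|f\|_1=\sum_{x\in S}|f(x)|<\infty$. For $f,g\in\ell^1(S)$ the dot product is $$(f\bullet g)(x)=\sum_{y\in S,\ yy^*=x^*x} f(xy)\,g(y^* )\qquad(x\in S),$$ and $\tilde f(x)=\overline{f(x^* )}$. *)

(* Defs.v *)
From mathcomp Require Import all_boot all_order all_algebra.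
From mathcomp Require Import finmap.
From mathcomp Require Import all_classical all_reals all_analysis.
From mathcomp Require Import complex.
From mathcomp Require summability.

Set Implicit Arguments.
Unset Strict Implicit.
Unset Printing Implicit Defensive.

Import Order.TTheory GRing.Theory Num.Theory.
Import numFieldNormedType.Exports.
Import ComplexField.

Local Open Scope classical_set_scope.
Local Open Scope ring_scope.
Local Open Scope complex_scope.

Definition inverse_semigroup (S : semigroupType) (star : S -> S) : Prop :=
  forall s : S,
    unique (fun t : S => (s * t * s = s)%g /\ (t * s * t = t)%g) (star s).

Section BanachStarAlgebra.
Variables (R : realType) (V : lmodType R[i]).

(* The underlying space is a subset [A] of an ambient complex vector space, and
   the operations are functions on the whole of [V]: nothing is required of
   them outside [A], and [A] must be closed under them. *)

Record banach_space (A : set V) (norm : V -> R) : Prop := {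
  bs_mem0 : A 0;
  bs_memD : forall u v, A u -> A v -> A (u + v);
  bs_memZ : forall (c : R[i]) u, A u -> A (c *: u);
  bs_norm_ge0 : forall u, A u -> 0 <= norm u;
  bs_norm_eq0 : forall u, A u -> norm u = 0 -> u = 0;
  bs_normZ : forall (c : R[i]) u, A u -> norm (c *: u) = Normc.normc c * norm u;
  bs_normD : forall u v, A u -> A v -> norm (u + v) <= norm u + norm v;
  bs_complete : forall u : nat -> V,
    (forall n, A (u n)) ->
    (forall e : R, 0 < e -> exists N : nat, forall m n : nat,
       (N <= m)%N -> (N <= n)%N -> norm (u m - u n) < e) ->
    exists2 l, A l & norm (u n - l) @[n --> \oo] --> (0 : R)
}.

Record banach_algebra (A : set V) (norm : V -> R) (mul : V -> V -> V) : Prop := {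
  ba_banach_space : banach_space A norm;
  ba_memM : forall u v, A u -> A v -> A (mul u v);
  ba_mulA : forall u v w, A u -> A v -> A w -> mul u (mul v w) = mul (mul u v) w;
  ba_mulDl : forall u v w, A u -> A v -> A w ->
    mul (u + v) w = mul u w + mul v w;
  ba_mulDr : forall u v w, A u -> A v -> A w ->
    mul u (v + w) = mul u v + mul u w;
  ba_mulZl : forall (c : R[i]) u v, A u -> A v -> mul (c *: u) v = c *: mul u v;
  ba_mulZr : forall (c : R[i]) u v, A u -> A v -> mul u (c *: v) = c *: mul u v;
  ba_normM : forall u v, A u -> A v -> norm (mul u v) <= norm u * norm v
}.

Record banach_star_algebra (A : set V) (norm : V -> R) (mul : V -> V -> V)
    (inv : V -> V) : Prop := {
  bsa_banach_algebra : banach_algebra A norm mul;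
  bsa_mem_inv : forall u, A u -> A (inv u);
  bsa_invK : forall u, A u -> inv (inv u) = u;
  bsa_invD : forall u v, A u -> A v -> inv (u + v) = inv u + inv v;
  bsa_invZ : forall (c : R[i]) u, A u -> inv (c *: u) = c^* *: inv u;
  bsa_invM : forall u v, A u -> A v -> inv (mul u v) = mul (inv v) (inv u);
  bsa_norm_inv : forall u, A u -> norm (inv u) = norm u
}.

End BanachStarAlgebra.

Section L1.
Variables (R : realType) (S : monoidType) (star : S -> S).
Implicit Types f g : S -> R[i].

Definition l1 : set (S -> R[i]) :=
  [set f | summable [set: S] (fun x => (Normc.normc (f x))%:E)].

Definition l1_norm f : R :=
  fine (\esum_(x in [set: S]) (Normc.normc (f x))%:E).

(* The sum is the limit of the net of finite partial sums; it converges
   absolutely for [f], [g] in [l1]. *)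
Definition dot f g : S -> R[i] := fun x =>
  @summability.sum S R[i] R[i]^o (fun y : S =>
    if (y * star y == star x * x)%g then f (x * y)%g * g (star y) else 0).

Definition tilde f : S -> R[i] := fun x => (f (star x))^*.

End L1.

(* Main.v *)
Require Import Defs.
From mathcomp Require Import all_boot all_order all_algebra.
From mathcomp Require Import finmap.
From mathcomp Require Import all_classical all_reals all_analysis.
From mathcomp Require Import complex.
From mathcomp Require summability.

(** On an inverse semigroup write d(x) = x^* x and r(x) = x x^*.  If
    y y^* = x^* x, the elements a = x y and b = y^* satisfy d(a) = r(b) and
    a b = x, and (a, b) determines (x, y).  So the dot product is the convolution

      (f . g)(x) = sum of f(a) g(b) over the pairs with a b = x, d(a) = r(b),

    of the groupoid underlying [S].  On point masses this reads:
    delta_a . delta_b is delta_(ab) if d(a) = r(b), and 0 otherwise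
    ([dot_point_mass]).

    Analysis.  Every estimate is a bound on finite sums ([l1_bounded]): a
    function lies in l1 exactly when its finite sums have a common bound, and the
    norm is the least such bound.  A pointwise limit of functions of norm at most
    [M] again has norm at most [M] ([fatou_l1]).  This one fact yields the
    completeness of l1, where the limit of a Cauchy sequence is taken pointwise,
    and the inequality |f . g| <= |f| |g|, where the dot product is the pointwise
    limit of its finite partial sums ([dot_bounded]).

    Algebra.  The maps f |-> f . g and g |-> f . g are bounded and linear, and
    bounded linear maps on l1 that agree on point masses are equal, because
    finite combinations of point masses are dense ([bop_ext]).  Associativity and
    the anti-multiplicativity of the involution are therefore checked on point
    masses, one variable at a time, with no rearrangement of infinite double
    sums.  There they reduce to the facts that, when d(a) = r(b),
    d(ab) = d(b) and r(ab) = r(a), and that (ab)^* = b^* a^* ([starM]). *)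

Set Implicit Arguments.
Unset Strict Implicit.
Unset Printing Implicit Defensive.

Import Order.TTheory GRing.Theory Num.Theory.
Import numFieldNormedType.Exports.
Import ComplexField.

Local Open Scope classical_set_scope.
Local Open Scope ring_scope.
Local Open Scope complex_scope.

Local Notation normc := Normc.normc.

(** * Inverse semigroups *)

Section InverseSemigroup.
Variables (S : semigroupType) (star : S -> S).
Hypothesis hS : inverse_semigroup star.
Local Open Scope group_scope.
Implicit Types (a b e f s t : S).

Lemma star_regular s : s * star s * s = s.
Proof. by have [[]] := hS s. Qed.

Lemma star_regularV s : star s * s * star s = star s.
Proof. by have [[]] := hS s. Qed.

Lemma star_unique s t : s * t * s = s -> t * s * t = t -> star s = t.
Proof. by move=> sts tst; have [_] := hS s; apply. Qed.

Lemma starK : involutive star.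
Proof.
by move=> s; apply: star_unique; [exact: star_regularV|exact: star_regular].
Qed.

Lemma star_idem e : e * e = e -> star e = e.
Proof. by move=> ee; apply: star_unique; rewrite !ee. Qed.

Lemma idem_mul_star s : s * star s * (s * star s) = s * star s.
Proof. by rewrite mulgA star_regular. Qed.

Lemma idem_star_mul s : star s * s * (star s * s) = star s * s.
Proof. by rewrite mulgA star_regularV. Qed.

(** With x = (ef)^*, the element f x e is also an inverse of ef, hence equals x.
    Then x is idempotent, so it is its own inverse, and ef = x^* = x. *)
Lemma idem_mul e f : e * e = e -> f * f = f -> e * f * (e * f) = e * f.
Proof.
move=> ee ff; set x := star (e * f).
have x1 : e * f * x * (e * f) = e * f by exact: star_regular.
have x2 : x * (e * f) * x = x by exact: star_regularV.
have fxe : f * x * e = x.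
  apply/esym/star_unique.
    transitivity (e * (f * f) * x * (e * e) * f); first by rewrite !mulgA.
    by rewrite ee ff -[RHS]x1 !mulgA.
  transitivity (f * x * (e * e) * (f * f) * x * e); first by rewrite !mulgA.
  by rewrite ee ff -[in RHS]x2 !mulgA.
have xx : x * x = x.
  by rewrite -[in LHS]fxe -[in RHS]fxe -[in RHS]x2 !mulgA.
have efx : e * f = x by rewrite -(star_idem xx) /x starK.
by rewrite efx.
Qed.

(** Both ef and fe are idempotent, and fe is an inverse of ef; but an idempotent
    is its own only inverse. *)
Lemma idem_comm e f : e * e = e -> f * f = f -> e * f = f * e.
Proof.
move=> ee ff; have ef := idem_mul ee ff; have fe := idem_mul ff ee.
rewrite -(star_idem ef); apply: star_unique.
  transitivity (e * (f * f) * (e * e) * f); first by rewrite !mulgA.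
  by rewrite ee ff -[RHS]ef !mulgA.
transitivity (f * (e * e) * (f * f) * e); first by rewrite !mulgA.
by rewrite ee ff -[RHS]fe !mulgA.
Qed.

(** Commuting the idempotents b b^* and a^* a turns a b b^* a^* a b into
    (a a^* a)(b b^* b). *)
Lemma starM a b : star (a * b) = star b * star a.
Proof.
have comm := idem_comm (idem_mul_star b) (idem_star_mul a).
apply: star_unique.
  transitivity (a * (b * star b * (star a * a)) * b); first by rewrite !mulgA.
  by rewrite comm !mulgA star_regular -2!(mulgA a) star_regular.
transitivity (star b * (star a * a * (b * star b)) * star a).
  by rewrite !mulgA.
by rewrite -comm !mulgA star_regularV -2!(mulgA (star b)) star_regularV.
Qed.
End InverseSemigroup.

(** * Limits of complex numbers *)

Section ComplexLimits.
Variable R : realType.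
Implicit Types (z s w : R[i]).

Lemma norm_normc z : `|z| = (normc z)%:C.
Proof. by case: z. Qed.

Lemma normc_ge0 z : 0 <= normc z.
Proof. by case: z => a b; rewrite sqrtr_ge0. Qed.

Lemma normc_conj z : normc z^* = normc z.
Proof. by case: z => a b; rewrite /= sqrrN. Qed.

Lemma ler_Re_normc z : `|complex.Re z| <= normc z.
Proof.
by case: z => a b; rewrite -sqrtr_sqr ler_wsqrtr//= lerDl sqr_ge0.
Qed.

Lemma ler_Im_normc z : `|complex.Im z| <= normc z.
Proof.
by case: z => a b; rewrite -sqrtr_sqr ler_wsqrtr//= lerDr sqr_ge0.
Qed.

Lemma ler_normc_ReIm z : normc z <= `|complex.Re z| + `|complex.Im z|.
Proof.
case: z => a b /=; rewrite -[leRHS]ger0_norm ?addr_ge0// -sqrtr_sqr.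
rewrite ler_wsqrtr// sqrrD !real_normK ?num_real// -addrA lerD2l lerDr.
by rewrite mulrn_wge0 ?mulr_ge0.
Qed.

Lemma ler_normc_sum (I : Type) (r : seq I) (P : pred I) (F : I -> R[i]) :
  normc (\sum_(i <- r | P i) F i) <= \sum_(i <- r | P i) normc (F i).
Proof.
elim/big_rec2: _ => [|i x y _ xy]; first by rewrite Normc.normc0.
by rewrite (le_trans (le_normcD _ _))// lerD2l.
Qed.

(** The topology of [R[i]] is defined with radii in [R[i]] itself; a positive
    radius there is a positive real number. *)
Lemma cvgcP (T : Type) (F : set_system T) {FF : Filter F} (z : T -> R[i]^o) s :
  z @ F --> (s : R[i]^o) <->
  (forall e : R, 0 < e -> \forall t \near F, normc (s - z t) < e).
Proof.
split=> [/cvgrPdist_lt zs e e0|zs].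
  have := zs e%:C; rewrite ltcR => /(_ e0).
  by apply: filterS => t; rewrite [X in X < _ -> _]norm_normc ltcR.
apply/cvgrPdist_lt => -[e e']; rewrite ltcE /= => /andP[/eqP -> e0].
have := zs e e0; apply: filterS => t.
by rewrite [X in _ -> X < _]norm_normc ltcR.
Qed.

Lemma cvg_normc (T : Type) (F : set_system T) {FF : Filter F}
    (z : T -> R[i]^o) s :
  z @ F --> (s : R[i]^o) -> normc (z t) @[t --> F] --> normc s.
Proof.
move=> /cvgcP zs; apply/cvgrPdist_lt => e e0.
have := zs e e0; apply: filterS => t; apply: le_lt_trans.
have le u v : normc u <= normc v + normc (u - v).
  by rewrite -{1}(subrK v u) addrC le_normcD.
rewrite ler_norml lerBlDl le andbT.
by rewrite lerBrDr addrC lerBlDr -(normcN (s - z t)) opprB le.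
Qed.

(** Stated for an arbitrary filter, to cover both Cauchy sequences and the net of
    finite partial sums of a family. *)
Lemma complex_complete (T : Type) (F : set_system T) {FF : ProperFilter F}
    (z : T -> R[i]^o) :
  (forall e : R, 0 < e -> exists c, \forall t \near F, normc (c - z t) < e) ->
  exists s, z @ F --> (s : R[i]^o).
Proof.
move=> zC.
have part (p : R[i] -> R) : (forall u v, p (u - v) = p u - p v) ->
    (forall u, `|p u| <= normc u) -> cvg (p (z t) @[t --> F]).
  move=> pB p_le; apply/cauchy_cvgP/cauchy_exP => e e0.
  have [c zc] := zC e e0; exists (p c); apply: filterS zc => t.
  by rewrite /ball /= -pB; apply: le_lt_trans.
have ReB u v : complex.Re (u - v) = complex.Re u - complex.Re v :> R.
  by case: u v => [? ?] [].
have ImB u v : complex.Im (u - v) = complex.Im u - complex.Im v :> R.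
  by case: u v => [? ?] [].
have /cvg_ex[a za] := part _ ReB ler_Re_normc.
have /cvg_ex[b zb] := part _ ImB ler_Im_normc.
exists (a +i* b); apply/cvgcP => e e0.
have e2 : 0 < e / 2 by rewrite divr_gt0.
move/cvgrPdist_lt: za => /(_ _ e2); move/cvgrPdist_lt: zb => /(_ _ e2).
apply: filterS2 => t zb za; rewrite (le_lt_trans (ler_normc_ReIm _))//.
by rewrite (splitr e); case: (z t) za zb => x y za zb; rewrite ltrD.
Qed.

End ComplexLimits.

(** * Absolutely summable complex families *)

#[local] Existing Instance summability.totally_filter.

Section Summation.
Variables (R : realType) (I : choiceType).
Implicit Types (f g : I -> R[i]) (M e : R).

Local Notation psum := (@summability.partial_sum I R[i]^o).
Local Notation csum := (@summability.sum I R[i] R[i]^o).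

(** The norm of [f] is at most [M], said with real finite sums only; no
    summability has to be known beforehand. *)
Definition l1_bounded f M : Prop :=
  forall r : seq I, uniq r -> \sum_(x <- r) normc (f x) <= M.

Lemma l1_boundedP f M :
  l1_bounded f M <-> (\esum_(x in [set: I]) (normc (f x))%:E <= M%:E)%E.
Proof.
split=> [fM|fM r ur].
  apply: ge_ereal_sup => _ [_ [/finite_fsetP[X ->] _] <-].
  by rewrite -(fsbig_seq _ _ (fset_uniq X)) sumEFin lee_fin; exact: fM.
rewrite -lee_fin; apply: le_trans fM; apply: ereal_sup_ubound.
exists [set` r]; first by split=> //; exact: finite_seq.
by rewrite -fsbig_seq// sumEFin.
Qed.

Lemma l1_bounded_ge0 f M : l1_bounded f M -> 0 <= M.
Proof. by move/(_ [::] isT); rewrite big_nil. Qed.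

Lemma l1_bounded_le f M x : l1_bounded f M -> normc (f x) <= M.
Proof. by move=> /(_ [:: x] isT); rewrite big_seq1. Qed.

Lemma l1_bounded_inj (J : eqType) (h : J -> I) (r : seq J) (P : pred J) f M :
  l1_bounded f M -> uniq r -> {in P &, injective h} ->
  \sum_(j <- r | P j) normc (f (h j)) <= M.
Proof.
move=> fM ur hP; rewrite -big_filter -(big_map h xpredT (fun x => normc (f x))).
apply: fM; rewrite map_inj_in_uniq ?filter_uniq// => i j.
by rewrite !mem_filter => /andP[Pi _] /andP[Pj _]; exact: hP.
Qed.

Lemma l1_boundedD f g M N :
  l1_bounded f M -> l1_bounded g N -> l1_bounded (f + g) (M + N).
Proof.
move=> fM gN r ur; rewrite (le_trans _ (lerD (fM r ur) (gN r ur)))//.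
by rewrite -big_split ler_sum// => x _; exact: le_normcD.
Qed.

Lemma l1_boundedZ (c : R[i]) f M :
  l1_bounded f M -> l1_bounded (c *: f) (normc c * M).
Proof.
move=> fM r ur; under eq_bigr do rewrite Normc.normcM.
by rewrite -mulr_sumr ler_wpM2l ?normc_ge0 ?fM.
Qed.

(** Take for [X] a finite set on which the sum is within [e] of the supremum of
    all finite sums. *)
Lemma l1_bounded_tail f M e : l1_bounded f M -> 0 < e ->
  exists X : {fset I}, l1_bounded (fun x => if x \in X then 0 else f x) e.
Proof.
move=> fM e0;
pose E := [set \sum_(x <- r) normc (f x) | r in [set r : seq I | uniq r]].
have E0 : has_sup E.
  split; first by exists 0, [::]; rewrite ?big_nil.
  by exists M => _ [r ur <-]; exact: fM.
have [_ [r ur <-] supr] := sup_adherent e0 E0.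
exists [fset x in r]%fset => r' ur'.
rewrite (eq_bigr (fun x => if x \notin r then normc (f x) else 0)); last first.
  by move=> x _; rewrite !inE; case: ifP; rewrite ?Normc.normc0.
rewrite -big_mkcond -(lerD2l (\sum_(x <- r) normc (f x))) /=.
have le_sup : \sum_(x <- r ++ [seq x <- r' | x \notin r]) normc (f x) <= sup E.
  apply: (ub_le_sup E0.2); exists (r ++ [seq x <- r' | x \notin r]) => //=.
  rewrite cat_uniq ur filter_uniq// andbT/=; apply/hasPn => x.
  by rewrite mem_filter => /andP[].
move: le_sup; rewrite big_cat big_filter /= => /le_trans; apply.
by rewrite -lerBlDr ltW.
Qed.

(** Each finite sum of norms is continuous in finitely many values of the
    function, so the bound passes to the limit. *)
Lemma fatou_l1 (T : Type) (F : set_system T) {FF : ProperFilter F}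
    (z : T -> I -> R[i]) f M :
  (forall x, z t x @[t --> F] --> (f x : R[i]^o)) ->
  (\forall t \near F, l1_bounded (z t) M) -> l1_bounded f M.
Proof.
move=> zf zM r ur.
apply: (@cvgr_to_le _ F _ _ (fun t => \sum_(x <- r) normc (z t x))).
  by apply: cvg_big => [|x _]; [exact: add_continuous|apply: cvg_normc].
by apply: filterS zM => t /(_ r ur).
Qed.

Lemma partial_sumE f (X : {fset I}) :
  psum f X = \sum_(x <- X) f x.
Proof. by rewrite big_seq_fsetE. Qed.

(** Beyond a finite set with a small tail, the partial sums differ by at most that
    tail, so they form a Cauchy net. *)
Lemma cvg_partial_sum f M : l1_bounded f M ->
  psum f @ summability.totally -->
    (csum f : R[i]^o).
Proof.
move=> fM.
suff [s fs] : exists s, psum f @ summability.totally -->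
    (s : R[i]^o).
  exact: (cvgP _ fs).
apply: complex_complete => e e0.
have e2 : 0 < e / 2 by rewrite divr_gt0.
have [X tailX] := l1_bounded_tail fM e2; exists (psum f X).
exists X => //= Y XY; rewrite -normcN opprB !partial_sumE.
rewrite (bigID (mem X)) /= -big_filter (perm_big X) /=; last first.
  apply: uniq_perm; rewrite ?filter_uniq ?fset_uniq// => x.
  by rewrite mem_filter andb_idr// => /(fsubsetP XY).
rewrite addrAC subrr add0r big_mkcond.
rewrite (le_lt_trans (ler_normc_sum _ _ _))//.
rewrite (le_lt_trans _ (midf_lt e0).2)// add0r.
apply: le_trans (tailX _ (fset_uniq Y)); apply: ler_sum => x _.
by rewrite if_neg.
Qed.

Lemma csumD f g M N : l1_bounded f M -> l1_bounded g N ->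
  csum (f + g) =
  csum f + csum g.
Proof.
move=> fM gN; apply: cvg_lim; first exact: norm_hausdorff.
rewrite (_ : psum _ =
  psum f + psum g).
  by apply: cvgD; apply: cvg_partial_sum; eassumption.
by apply/funext => X; rewrite /psum big_split.
Qed.

Lemma csumZ (c : R[i]) f M : l1_bounded f M ->
  csum (c *: f) =
  c * csum f.
Proof.
move=> fM; apply: cvg_lim; first exact: norm_hausdorff.
rewrite (_ : psum _ = c \*: psum f).
  by apply: cvgZl_tmp; apply: cvg_partial_sum; eassumption.
by apply/funext => X; rewrite /psum -scaler_sumr.
Qed.

Lemma csum_supp1 f x0 : (forall x, x != x0 -> f x = 0) ->
  csum f = f x0.
Proof.
move=> f0; apply: lim_near_cst; first exact: norm_hausdorff.
exists [fset x0]%fset => //= X /fsubsetP/(_ x0 (fset11 x0)) x0X.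
rewrite partial_sumE (bigD1_seq x0)//= big1 ?addr0// => x; exact: f0.
Qed.

End Summation.

(** * The Banach space l1 *)

Section L1Space.
Variables (R : realType) (S : monoidType).
Implicit Types (f g : S -> R[i]) (M e : R) (c : R[i]) (x y : S).

Lemma l1_boundedW f M : l1_bounded f M -> l1 f /\ l1_norm f <= M.
Proof.
move/l1_boundedP => fM.
have ge0 : (0 <= \esum_(x in [set: S]) (normc (f x))%:E)%E.
  by apply: esum_ge0 => x _; rewrite lee_fin normc_ge0.
split; last first.
  rewrite -lee_fin /l1_norm fineK//.
  by rewrite ge0_fin_numE// (le_lt_trans fM)// ltry.
rewrite /l1 /= /summable; under eq_esum do rewrite gee0_abs ?lee_fin ?normc_ge0//.
by rewrite (le_lt_trans fM)// ltry.
Qed.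

Lemma l1_norm_bounded f : l1 f -> l1_bounded f (l1_norm f).
Proof.
rewrite /l1 /= /summable.
under eq_esum do rewrite gee0_abs ?lee_fin ?normc_ge0//.
move=> foo; apply/l1_boundedP; rewrite /l1_norm fineK// ge0_fin_numE//.
by apply: esum_ge0 => x _; rewrite lee_fin normc_ge0.
Qed.

Lemma l1_normD f g : l1 f -> l1 g -> l1 (f + g) /\
  l1_norm (f + g) <= l1_norm f + l1_norm g.
Proof.
by move=> /l1_norm_bounded ff /l1_norm_bounded gg; exact/l1_boundedW/l1_boundedD.
Qed.

Lemma l1_normZ_le c f : l1 f -> l1 (c *: f) /\
  l1_norm (c *: f) <= normc c * l1_norm f.
Proof. by move=> /l1_norm_bounded ff; exact/l1_boundedW/l1_boundedZ. Qed.

Lemma l1B f g : l1 f -> l1 g -> l1 (f - g).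
Proof.
move=> fl gl; rewrite -scaleN1r.
by have [] := l1_normD fl (l1_normZ_le (-1) gl).1.
Qed.

Lemma l1_bounded0 : l1_bounded (0 : S -> R[i]) 0.
Proof. by move=> r _; rewrite big1// => x _; rewrite Normc.normc0. Qed.

Lemma l1_norm_ge0 f : l1 f -> 0 <= l1_norm f.
Proof. by move/l1_norm_bounded/l1_bounded_ge0. Qed.

(** The nontrivial inequality is the trivial one for [c^-1] and [c *: f]. *)
Lemma l1_normZ c f : l1 f -> l1_norm (c *: f) = normc c * l1_norm f.
Proof.
move=> fl; have [cfl le_cf] := l1_normZ_le c fl.
apply/eqP; rewrite eq_le le_cf/=; have [->|c0] := eqVneq c 0.
  by rewrite Normc.normc0 mul0r scale0r l1_norm_ge0//;
    case: (l1_boundedW l1_bounded0).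
have nc0 : 0 < normc c.
  rewrite lt_def normc_ge0 andbT; apply: contra_neq c0; exact: Normc.eq0_normc.
rewrite -ler_pdivlMl// -Normc.normcV; have [_] := l1_normZ_le c^-1 cfl.
by rewrite scalerK.
Qed.

(** The limit is taken pointwise.  It is a limit in norm because, for fixed large
    [n], the function [u n - l] is the pointwise limit of the [u n - u m], all of
    norm at most [e]. *)
Lemma l1_complete (u : nat -> S -> R[i]) : (forall n, l1 (u n)) ->
  (forall e, 0 < e -> exists N : nat, forall m n : nat,
    (N <= m)%N -> (N <= n)%N -> l1_norm (u m - u n) < e) ->
  exists2 l, l1 l & l1_norm (u n - l) @[n --> \oo] --> (0 : R).
Proof.
move=> ul uC.
have uxC x : exists s : R[i], u n x @[n --> \oo] --> (s : R[i]^o).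
  apply: complex_complete => e /uC[N uN]; exists (u N x).
  exists N => // n Nn; apply: le_lt_trans (uN N n _ Nn) => //.
  exact: l1_bounded_le (l1_norm_bounded (l1B (ul N) (ul n))).
have [l ul_cvg] := choice uxC.
have near_l e : 0 < e -> exists N : nat, forall n, (N <= n)%N ->
    l1_bounded (u n - l) e.
  move=> /uC[N uN]; exists N => n Nn.
  apply: (@fatou_l1 _ _ _ \oo _ (fun m => u n - u m)).
    by move=> x; apply: (@cvgB _ R[i]^o); [exact: cvg_cst|exact: ul_cvg].
  exists N => // m Nm r ur; apply: le_trans (ltW (uN _ _ Nn Nm)).
  exact: l1_norm_bounded (l1B (ul n) (ul m)) r ur.
exists l.
  have [N /(_ N (leqnn N)) uNl] := near_l 1 ltr01.
  rewrite -(subKr (u N) l); apply: l1B => //.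
  by case: (l1_boundedW uNl).
apply/cvgrPdist_le => e /near_l[N uN]; exists N => // n /uN/l1_boundedW[unl le_e].
by rewrite sub0r normrN ger0_norm// l1_norm_ge0.
Qed.

Lemma banach_space_l1 : banach_space (@l1 R S) (@l1_norm R S).
Proof.
split.
- by case: (l1_boundedW l1_bounded0).
- by move=> f g fl gl; case: (l1_normD fl gl).
- by move=> c f fl; case: (l1_normZ_le c fl).
- exact: l1_norm_ge0.
- move=> f /l1_norm_bounded + f0; rewrite f0 => ff; apply/funext => x.
  apply: Normc.eq0_normc; apply/eqP; rewrite eq_le normc_ge0 andbT.
  exact: l1_bounded_le ff.
- exact: l1_normZ.
- by move=> f g fl gl; case: (l1_normD fl gl).
- exact: l1_complete.
Qed.

(** * Density of the point masses *)

Definition point_mass (a : S) : S -> R[i] := fun x => (x == a)%:R.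

Lemma l1_point_mass a : l1 (point_mass a).
Proof.
suff /l1_boundedW[] : l1_bounded (point_mass a) 1 by [].
move=> r ur; have [ar|ar] := boolP (a \in r).
  rewrite (bigD1_seq a)//= big1 ?addr0 => [|x /negPf xa].
    by rewrite /point_mass eqxx Normc.normc1.
  by rewrite /point_mass xa Normc.normc0.
rewrite big1_seq// => x /andP[_ xr].
rewrite /point_mass (_ : x == a = false) ?Normc.normc0//.
by apply: contraNF ar => /eqP <-.
Qed.

(** The last clause also says that [T] maps l1 into l1. *)
Record bounded_operator (T : (S -> R[i]) -> S -> R[i]) : Prop := {
  bopD : forall f g, l1 f -> l1 g -> T (f + g) = T f + T g;
  bopZ : forall c f, l1 f -> T (c *: f) = c *: T f;
  bop_bounded : exists K, forall f M,
    l1_bounded f M -> l1_bounded (T f) (K * M)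
}.

Lemma bop0 T : bounded_operator T -> T 0 = 0.
Proof.
by move=> bT; rewrite -(scale0r 0) bopZ ?scale0r//;
  case: (l1_boundedW l1_bounded0).
Qed.

Lemma bop_l1 T f : bounded_operator T -> l1 f -> l1 (T f).
Proof.
by case=> _ _ [K bT] /l1_norm_bounded/bT/l1_boundedW[].
Qed.

Lemma bop_comp T1 T2 : bounded_operator T1 -> bounded_operator T2 ->
  bounded_operator (T1 \o T2).
Proof.
move=> b1 b2; split=> [f g fl gl|c f fl|] /=.
- by rewrite (bopD b2)// (bopD b1)//; exact: bop_l1.
- by rewrite (bopZ b2)// (bopZ b1)//; exact: bop_l1.
- have [K1 h1] := bop_bounded b1; have [K2 h2] := bop_bounded b2.
  by exists (K1 * K2) => f M fM; rewrite -mulrA; exact/h1/h2.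
Qed.

Lemma bop_sub T1 T2 : bounded_operator T1 -> bounded_operator T2 ->
  bounded_operator (fun f => T1 f - T2 f).
Proof.
move=> b1 b2; split=> [f g fl gl|c f fl|] /=.
- by rewrite (bopD b2)// (bopD b1)// opprD addrACA.
- by rewrite (bopZ b2)// (bopZ b1)// scalerBr.
- have [K1 h1] := bop_bounded b1; have [K2 h2] := bop_bounded b2.
  exists (K1 + K2) => f M fM; rewrite mulrDl -scaleN1r.
  apply: l1_boundedD; first exact: h1.
  by rewrite -(mul1r (K2 * M)) -(Normc.normc1 R) -normcN; exact/l1_boundedZ/h2.
Qed.

Lemma finite_part_decomposition f (X : {fset S}) :
  f = \sum_(a <- X) f a *: point_mass a + (fun x => if x \in X then 0 else f x).
Proof.
apply/funext => x; rewrite [RHS]/GRing.add /= fct_sumE.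
transitivity (\sum_(a <- X) f a * point_mass a x +
              (if x \in X then 0 else f x)) => //.
case: ifPn => xX.
  rewrite addr0 (bigD1_seq x) ?fset_uniq//= big1 => [|a /negPf ax].
    by rewrite /point_mass eqxx mulr1 addr0.
  by rewrite /point_mass eq_sym ax mulr0.
rewrite big1_seq ?add0r// => a /andP[_ aX].
rewrite /point_mass (_ : x == a = false) ?mulr0//.
by apply: contraNF xX => /eqP ->.
Qed.

(** [T f] is the image of a tail of [f], whose norm is arbitrarily small. *)
Lemma bop_eq0 T f : bounded_operator T -> (forall a, T (point_mass a) = 0) ->
  l1 f -> T f = 0.
Proof.
move=> bT T0 fl; have [K TK] := bop_bounded bT.
suff Tf e : 0 < e -> l1_bounded (T f) (K * e).
  apply/funext => x; apply: Normc.eq0_normc; apply/eqP.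
  rewrite eq_le normc_ge0 andbT.
  apply/ler_addgt0Pl => e e0; rewrite addr0.
  have K0 : 0 < `|K| + 1 by rewrite ltr_wpDl.
  apply: le_trans (l1_bounded_le x (Tf (e / (`|K| + 1)) _)) _;
    first exact: divr_gt0.
  rewrite mulrCA ger_pMr// ler_pdivrMr// mul1r.
  by rewrite (le_trans (ler_norm K))// lerDl.
move=> e0; have [X tailX] := l1_bounded_tail (l1_norm_bounded fl) e0.
have [sl TsX] : l1 (\sum_(a <- X) f a *: point_mass a) /\
    T (\sum_(a <- X) f a *: point_mass a) = 0.
  apply: (big_ind (fun g => l1 g /\ T g = 0)).
  - by split; [case: (l1_boundedW l1_bounded0)|exact: bop0].
  - move=> g h [gl Tg] [hl Th]; rewrite (bopD bT)// Tg Th addr0.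
    by case: (l1_normD gl hl).
  - move=> a _; rewrite (bopZ bT) ?T0 ?scaler0; last exact: l1_point_mass.
    by case: (l1_normZ_le (f a) (l1_point_mass a)).
rewrite {1}(finite_part_decomposition f X) (bopD bT)// ?TsX ?add0r; first exact: TK.
by case: (l1_boundedW tailX).
Qed.

Lemma bop_ext T1 T2 f : bounded_operator T1 -> bounded_operator T2 ->
  (forall a, T1 (point_mass a) = T2 (point_mass a)) -> l1 f -> T1 f = T2 f.
Proof.
move=> b1 b2 T12 fl; apply/eqP; rewrite -subr_eq0; apply/eqP.
apply: (bop_eq0 (bop_sub b1 b2)) => // a.
by rewrite T12 subrr.
Qed.

End L1Space.

(** * The dot product *)

Section DotProduct.
Variables (R : realType) (S : monoidType) (star : S -> S).
Hypothesis hS : inverse_semigroup star.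
Implicit Types (f g h : S -> R[i]) (M N : R) (c : R[i]) (a b x y : S).

Local Notation dot := (@dot R S star).
Local Notation tilde := (@tilde R S star).
Local Notation delta := (@point_mass R S).

Definition dot_term f g x : S -> R[i] := fun y =>
  if (y * star y == star x * x)%g then f (x * y)%g * g (star y) else 0.

Lemma normc_dot_term f g x y : normc (dot_term f g x y) =
  if (y * star y == star x * x)%g then normc (f (x * y)%g) * normc (g (star y))
  else 0.
Proof. by rewrite /dot_term; case: ifP; rewrite ?Normc.normcM ?Normc.normc0. Qed.

Lemma l1_bounded_star f M : l1_bounded f M -> l1_bounded (f \o star) M.
Proof.
move=> fM r ur; apply: (l1_bounded_inj fM) => // x y _ _.
exact: (can_inj (starK hS)).
Qed.

Lemma dot_term_bounded f g x M N :
  l1_bounded f M -> l1_bounded g N -> l1_bounded (dot_term f g x) (M * N).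
Proof.
move=> fM gN r ur.
apply: (@le_trans _ _ (\sum_(y <- r) M * normc (g (star y)))).
  apply: ler_sum => y _; rewrite normc_dot_term; case: ifP => _.
    by rewrite ler_wpM2r ?normc_ge0// l1_bounded_le.
  by rewrite mulr_ge0 ?normc_ge0// (l1_bounded_ge0 fM).
rewrite -mulr_sumr ler_wpM2l ?(l1_bounded_ge0 fM)//.
exact: (l1_bounded_star gN).
Qed.

(** After exchanging the two sums it remains to bound, for fixed [y], the sum of
    |f(xy)| over the [x] with x^* x = y y^*.  On these [x] right multiplication by
    [y] is injective, since x = x x^* x = (xy) y^*; so the norm of [f] is a bound. *)
Lemma dot_bounded f g M N :
  l1_bounded f M -> l1_bounded g N -> l1_bounded (dot f g) (M * N).
Proof.
move=> fM gN.
apply: (@fatou_l1 _ _ _ _ (summability.totally_filter (I := S))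
  (fun X x => @summability.partial_sum S R[i]^o (dot_term f g x) X)).
  by move=> x; exact: (cvg_partial_sum (dot_term_bounded x fM gN)).
apply: nearW => X r ur.
apply: (@le_trans _ _ (\sum_(x <- r) \sum_(y <- X) normc (dot_term f g x y))).
  by apply: ler_sum => x _; rewrite partial_sumE; exact: ler_normc_sum.
rewrite exchange_big /=.
apply: (@le_trans _ _ (\sum_(y <- X) M * normc (g (star y)))); last first.
  rewrite -mulr_sumr ler_wpM2l ?(l1_bounded_ge0 fM)//.
  exact/(l1_bounded_star gN)/fset_uniq.
apply: ler_sum => y _; under eq_bigr do rewrite normc_dot_term.
rewrite -big_mkcond -mulr_suml ler_wpM2r ?normc_ge0//=.
apply: (l1_bounded_inj (h := fun x => (x * y)%g) fM ur) => x x'.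
rewrite !unfold_in => /eqP xy /eqP x'y xyE.
rewrite -(star_regular hS x) -(star_regular hS x') -!mulgA -xy -x'y !mulgA.
by rewrite xyE.
Qed.

Lemma dotDl f g h : l1 f -> l1 g -> l1 h -> dot (f + g) h = dot f h + dot g h.
Proof.
move=> /l1_norm_bounded fb /l1_norm_bounded gb /l1_norm_bounded hb.
apply/funext => x; apply: etrans
  (csumD (dot_term_bounded x fb hb) (dot_term_bounded x gb hb)).
apply: (congr1 (@summability.sum S R[i] R[i]^o)); apply/funext => y.
rewrite [RHS]/GRing.add/= /dot_term.
by case: ifP => _; rewrite ?addr0// -mulrDl.
Qed.

Lemma dotDr f g h : l1 f -> l1 g -> l1 h -> dot f (g + h) = dot f g + dot f h.
Proof.
move=> /l1_norm_bounded fb /l1_norm_bounded gb /l1_norm_bounded hb.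
apply/funext => x; apply: etrans
  (csumD (dot_term_bounded x fb gb) (dot_term_bounded x fb hb)).
apply: (congr1 (@summability.sum S R[i] R[i]^o)); apply/funext => y.
rewrite [RHS]/GRing.add/= /dot_term.
by case: ifP => _; rewrite ?addr0// -mulrDr.
Qed.

Lemma dotZl c f g : l1 f -> l1 g -> dot (c *: f) g = c *: dot f g.
Proof.
move=> /l1_norm_bounded fb /l1_norm_bounded gb.
apply/funext => x; apply: etrans (csumZ c (dot_term_bounded x fb gb)).
apply: (congr1 (@summability.sum S R[i] R[i]^o)); apply/funext => y.
rewrite [RHS]/GRing.scale/= /dot_term.
by case: ifP => _; [exact/esym/mulrA|exact/esym/mulr0].
Qed.

Lemma dotZr c f g : l1 f -> l1 g -> dot f (c *: g) = c *: dot f g.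
Proof.
move=> /l1_norm_bounded fb /l1_norm_bounded gb.
apply/funext => x; apply: etrans (csumZ c (dot_term_bounded x fb gb)).
apply: (congr1 (@summability.sum S R[i] R[i]^o)); apply/funext => y.
rewrite [RHS]/GRing.scale/= /dot_term.
by case: ifP => _; [exact: mulrCA|exact/esym/mulr0].
Qed.

Lemma l1_dot f g : l1 f -> l1 g -> l1 (dot f g).
Proof.
move=> /l1_norm_bounded fb /l1_norm_bounded gb.
by case: (l1_boundedW (dot_bounded fb gb)).
Qed.

Lemma bop_dotl g : l1 g -> bounded_operator (dot^~ g).
Proof.
move=> gl; split=> [f h fl hl|c f fl|]; [exact: dotDl|exact: dotZl|].
exists (l1_norm g) => f M fM; rewrite mulrC.
exact/dot_bounded/l1_norm_bounded.
Qed.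

Lemma bop_dotr f : l1 f -> bounded_operator (dot f).
Proof.
move=> fl; split=> [g h gl hl|c g gl|]; [exact: dotDr|exact: dotZr|].
exists (l1_norm f) => g M gM; exact/dot_bounded/gM/l1_norm_bounded.
Qed.

Lemma tilde_bounded f M : l1_bounded f M -> l1_bounded (tilde f) M.
Proof.
move=> fM r ur; under eq_bigr do rewrite normc_conj.
exact: (l1_bounded_star fM).
Qed.

Lemma l1_tilde f : l1 f -> l1 (tilde f).
Proof. by move=> /l1_norm_bounded/tilde_bounded/l1_boundedW[]. Qed.

Lemma tildeK : involutive tilde.
Proof. by move=> f; apply/funext => x; rewrite /Defs.tilde (starK hS) conjcK. Qed.

Lemma tildeD f g : tilde (f + g) = tilde f + tilde g.
Proof. by apply/funext => x; rewrite [RHS]/GRing.add/= /Defs.tilde rmorphD. Qed.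

Lemma tildeZ c f : tilde (c *: f) = c^* *: tilde f.
Proof. by apply/funext => x; rewrite [RHS]/GRing.scale/= /Defs.tilde rmorphM. Qed.

Lemma bop_tilde T : bounded_operator T -> bounded_operator (tilde \o T \o tilde).
Proof.
move=> bT; split=> [f g fl gl|c f fl|] /=.
- by rewrite tildeD (bopD bT) ?tildeD//; exact: l1_tilde.
- by rewrite tildeZ (bopZ bT) ?tildeZ ?conjCK//; exact: l1_tilde.
- by have [K TK] := bop_bounded bT; exists K => f M fM;
     exact/tilde_bounded/TK/tilde_bounded.
Qed.

Lemma tilde_point_mass a : tilde (delta a) = delta (star a).
Proof.
apply/funext => x; rewrite /Defs.tilde /point_mass rmorph_nat.
by rewrite -{1}(starK hS a) (inj_eq (can_inj (starK hS))).
Qed.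

(** Only the index y = b^* contributes, and its contribution at [x] is 1 exactly
    when b^* b = x^* x and x b^* = a.  These two equations are equivalent to
    a^* a = b b^* and x = ab. *)
Lemma dot_point_mass a b : dot (delta a) (delta b) =
  if (star a * a == b * star b)%g then delta (a * b)%g else 0.
Proof.
apply/funext => x; rewrite /Defs.dot (csum_supp1 (x0 := star b)); last first.
  move=> y yb; case: ifP => // _;
  rewrite /point_mass (_ : star y == b = false) ?mulr0//.
  by apply: contraNF yb => /eqP <-; rewrite (starK hS).
rewrite /point_mass (starK hS) eqxx mulr1.
transitivity (((star b * b == star x * x) && (x * star b == a))%g%:R : R[i]).
  by case: ifP.
transitivity (((star a * a == b * star b) && (x == a * b))%g%:R : R[i]);
  last by case: ifP.
congr (_%:R); congr nat_of_bool; apply/andP/andP => -[/eqP e1 /eqP e2].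
  split; apply/eqP; last by rewrite -e2 -mulgA e1 mulgA (star_regular hS).
  by rewrite -e2 (starM hS) (starK hS) -mulgA (mulgA _ x) -e1
     !mulgA (star_regular hS).
split; apply/eqP; rewrite e2 ?(starM hS).
  by rewrite -mulgA (mulgA (star a)) e1 !mulgA (star_regularV hS).
by rewrite -mulgA -e1 mulgA (star_regular hS).
Qed.

(** Both sides are delta_(abd) when b^* b = d d^* and a^* a = b b^*, and 0
    otherwise: under the first condition (bd)(bd)^* = b b^*, under the second
    (ab)^* (ab) = b^* b. *)
Lemma dot_point_massA a b d : dot (delta a) (dot (delta b) (delta d)) =
  dot (dot (delta a) (delta b)) (delta d).
Proof.
transitivity (if ((star b * b == d * star d) && (star a * a == b * star b))%g
              then delta (a * b * d)%g else 0).
  rewrite (dot_point_mass b); case: eqP => [bd|_] /=; last first.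
    exact: (bop0 (bop_dotr (l1_point_mass R a))).
  rewrite dot_point_mass mulgA (_ : b * d * star (b * d) = b * star b)%g//.
  by rewrite (starM hS) -mulgA (mulgA d) -bd !mulgA (star_regular hS).
rewrite (dot_point_mass a) andbC; case: eqP => [ab|_] /=; last first.
  exact/esym/(bop0 (bop_dotl (l1_point_mass R d))).
rewrite dot_point_mass (_ : star (a * b) * (a * b) = star b * b)%g//.
by rewrite (starM hS) -mulgA (mulgA (star a)) ab !mulgA (star_regularV hS).
Qed.

Lemma dotA f g h : l1 f -> l1 g -> l1 h -> dot f (dot g h) = dot (dot f g) h.
Proof.
move=> fl gl hl.
apply: (@bop_ext _ _ (dot^~ (dot g h)) (dot^~ h \o dot^~ g)) => // [||a].
- exact/bop_dotl/l1_dot.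
- by apply: bop_comp; exact: bop_dotl.
have al := l1_point_mass R a.
apply: (@bop_ext _ _ (dot (delta a) \o dot^~ h)
  (dot^~ h \o dot (delta a))) => //.
- by apply: bop_comp; [exact: bop_dotr|exact: bop_dotl].
- by apply: bop_comp; [exact: bop_dotl|exact: bop_dotr].
move=> b /=; have bl := l1_point_mass R b.
apply: (@bop_ext _ _ (dot (delta a) \o dot (delta b))
  (dot (dot (delta a) (delta b)))) => //.
- by apply: bop_comp; exact: bop_dotr.
- exact/bop_dotr/l1_dot.
by move=> d; exact: dot_point_massA.
Qed.

Lemma tilde_dot_point_mass a b :
  tilde (dot (delta a) (delta b)) = dot (tilde (delta b)) (tilde (delta a)).
Proof.
rewrite !tilde_point_mass !dot_point_mass !(starK hS) eq_sym; case: ifP => _.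
  by rewrite tilde_point_mass (starM hS).
by apply/funext => x; rewrite /Defs.tilde conjc0.
Qed.

(** In this form both sides would be conjugate-linear; moving one [tilde] across
    gives maps that are linear in [f] and in [g]. *)
Lemma tilde_dot f g : l1 f -> l1 g -> tilde (dot f g) = dot (tilde g) (tilde f).
Proof.
move=> fl gl; apply: (can_inj tildeK); rewrite tildeK.
apply: (@bop_ext _ _ (dot^~ g) (tilde \o dot (tilde g) \o tilde)) => // [||a].
- exact: bop_dotl.
- exact/bop_tilde/bop_dotr/l1_tilde.
have al := l1_point_mass R a.
apply: (@bop_ext _ _ (dot (delta a))
  (tilde \o dot^~ (tilde (delta a)) \o tilde)) => //.
- exact: bop_dotr.
- exact/bop_tilde/bop_dotl/l1_tilde.
by move=> b /=; rewrite -tilde_dot_point_mass tildeK.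
Qed.

Lemma l1_norm_tilde f : l1 f -> l1_norm (tilde f) = l1_norm f.
Proof.
have le g : l1 g -> l1_norm (tilde g) <= l1_norm g.
  by move=> /l1_norm_bounded/tilde_bounded/l1_boundedW[].
move=> fl; apply/eqP; rewrite eq_le le//= -{1}(tildeK f).
exact/le/l1_tilde.
Qed.

End DotProduct.

Theorem theorem3p1 (R : realType) (S : monoidType) (star : S -> S)
    (hS : inverse_semigroup star) :
  banach_star_algebra (@l1 R S) (@l1_norm R S) (@dot R S star) (@tilde R S star).
Proof.
split.
- split.
  + exact: banach_space_l1.
  + by move=> f g; exact: l1_dot.
  + by move=> f g h; exact: dotA.
  + by move=> f g h; exact: dotDl.
  + by move=> f g h; exact: dotDr.
  + by move=> c f g; exact: dotZl.
  + by move=> c f g; exact: dotZr.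
  + move=> f g /l1_norm_bounded fb /l1_norm_bounded gb.
    by case: (l1_boundedW (dot_bounded hS fb gb)).
- by move=> f; exact: l1_tilde.
- by move=> f _; exact: tildeK.
- by move=> f g _ _; exact: tildeD.
- by move=> c f _; exact: tildeZ.
- by move=> f g; exact: tilde_dot.
- by move=> f; exact: l1_norm_tilde.
Qed.
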